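(* Let $b\geq 4$ be an integer and let $G$ be a finite simple graph with minimum degree $\delta\geq 2$ and independence number $\alpha$ such that $\alpha>\frac{b(\delta-1)}{2}$. Then there exists a pseudo $[2,b]$-factor of $G$ such that, letting $F$ be the union of its components having at least three vertices, the subgraph $G-F$ of $G$ induced by $V(G)\setminus V(F)$ satisfies $\alpha(G-F)\leq \alpha-\lfloor\frac{b}{2}(\delta-1)\rfloor$.
   Context: A factor of a graph $G$ is a spanning subgraph of $G$. For an integer $b\geq 2$, a pseudo $[2,b]$-factor of $G$ is a factor of $G$ in which every connected component $C$ having at least three vertices satisfies $2\leq d_C(x)\leq b$ for every vertex $x$ of $C$ (so all other components are single vertices or single edges). For a subgraph $H$ of $G$, $\alpha(H)$ denotes the independence number of $H$, and $\alpha=\alpha(G)$. *)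

(* Defs.v *)
(* A finite simple graph is a symmetric irreflexive relation on a finType of
   vertices. *)
From mathcomp Require Import all_boot.
Set Implicit Arguments.
Unset Strict Implicit.
Unset Printing Implicit Defensive.

Definition degree (T : finType) (e : rel T) (x : T) : nat := #|[set y | e x y]|.

(* Degrees in a simple graph are smaller than #|T|, so the seed #|T| never
   affects the minimum when T is nonempty; the graph with no vertex gets 0. *)
Definition min_degree (T : finType) (e : rel T) : nat :=
  \big[minn/#|T|]_(x : T) degree e x.

Definition independent (T : finType) (e : rel T) (S : {set T}) : bool :=
  [forall x in S, forall y in S, ~~ e x y].

Definition indep_num (T : finType) (e : rel T) : nat :=
  \max_(S : {set T} | independent e S) #|S|.

Definition induced (T : finType) (e : rel T) (A : {set T}) :
    rel {x : T | x \in A} :=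
  [rel u v | e (val u) (val v)].
Arguments induced {T} e A.

(* A factor is given by its edge relation, the vertex set T being shared;
   irreflexivity is inherited from e. *)
Definition is_factor (T : finType) (e f : rel T) : Prop :=
  symmetric f /\ subrel f e.

Definition components (T : finType) (f : rel T) : {set {set T}} :=
  [set [set y | connect f x y] | x : T].

Definition degree_in (T : finType) (f : rel T) (C : {set T}) (x : T) : nat :=
  #|[set y in C | f x y]|.

Definition pseudo_2b_factor (T : finType) (e : rel T) (b : nat) (f : rel T) :
    Prop :=
  is_factor e f /\
  forall C : {set T}, C \in components f -> 3 <= #|C| ->
    forall x : T, x \in C -> 2 <= degree_in f C x <= b.

Definition large_vertices (T : finType) (f : rel T) : {set T} :=
  \bigcup_(C in components f | 3 <= #|C|) C.

(* Main.v *)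
Require Import Defs.
From mathcomp Require Import all_boot zify.
Set Implicit Arguments.
Unset Strict Implicit.
Unset Printing Implicit Defensive.

(* Among the subgraphs F of G whose nonzero degrees lie in [2, b], take one
   covering a largest vertex set W and, subject to that, having fewest edges.
   Maximality makes G - W a forest, and any path of G - W whose two ends are
   joined to vertices of F-degree < b could be absorbed by F.  Hence some leaf
   or isolated vertex x of G - W has about delta - 1 neighbours h of F-degree b.
   By minimality the F-neighbours of such an h have F-degree 2, and two
   F-neighbours of these h's are adjacent in G only if they are adjacent in F
   (otherwise a swap saves an edge or absorbs x); so they contain an independent
   set Y with 2 |Y| >= sum of the F-degrees of the h's.  If a vertex z of G - W
   is adjacent to such a neighbour y of h, then delete hy, attach x to h and z
   to y, and repeat from a suitable leaf of the tree containing z; were this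
   always possible the process would close up into a cyclic exchange enlarging
   W.  So for some x no vertex of G - W has a neighbour in Y, and Y extends
   every independent set of G - W. *)

(* Exchanges are carried out on symmetric multiplicity functions: their degrees
   are additive without any disjointness condition, and being simple and
   contained in G is the single pointwise bound [m u v <= e u v]. *)
Section Multigraphs.

Variable T : finType.
Implicit Types (m : T -> T -> nat) (a c u v x y : T) (p : seq T).

Definition mdeg m u := \sum_v m u v.

Definition edge a c u v : nat :=
  ((u == a) && (v == c)) + ((u == c) && (v == a)).

Fixpoint walk x p u v : nat :=
  if p is y :: p' then edge x y u v + walk y p' u v else 0.

Lemma edgeC a c u v : edge a c u v = edge a c v u.
Proof. by rewrite /edge addnC andbC [in X in _ + X]andbC. Qed.

Lemma walkC x p u v : walk x p u v = walk x p v u.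
Proof. by elim: p x => //= y p IH x; rewrite edgeC IH. Qed.

Lemma sum_eq_and (P : bool) a : \sum_v (P && (v == a)) = P :> nat.
Proof.
rewrite (bigD1 a) //= eqxx andbT big1 ?addn0 // => v /negbTE->.
by rewrite andbF.
Qed.

Lemma mdegD m1 m2 u :
  mdeg (fun x y => m1 x y + m2 x y) u = mdeg m1 u + mdeg m2 u.
Proof. exact: big_split. Qed.

Lemma mdegB m1 m2 u : (forall v, m2 u v <= m1 u v) ->
  mdeg (fun x y => m1 x y - m2 x y) u = mdeg m1 u - mdeg m2 u.
Proof. by move=> le21; rewrite /mdeg sumnB. Qed.

Lemma mdeg_sum (I : finType) (P : pred I) (m : I -> T -> T -> nat) u :
  mdeg (fun x y => \sum_(i | P i) m i x y) u = \sum_(i | P i) mdeg (m i) u.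
Proof. exact: exchange_big. Qed.

Lemma mdeg_edge a c u : mdeg (edge a c) u = (u == a) + (u == c).
Proof. by rewrite mdegD /mdeg !sum_eq_and. Qed.

Lemma mdeg_walk x p u :
  mdeg (walk x p) u = count_mem u (belast x p) + count_mem u p.
Proof.
elim: p x => [|y p IH] x /=; first by rewrite /mdeg big1.
by rewrite mdegD mdeg_edge IH [x == u]eq_sym [y == u]eq_sym addnACA.
Qed.

(** Inner vertices of a path have degree 2 and its ends degree 1. The two end terms even this out,
    and also cover the one-vertex path, where both fall on [x]. *)
Lemma mdeg_uniq_walk x p u : uniq (x :: p) ->
  mdeg (walk x p) u + (u == x) + (u == last x p) = 2 * (u \in x :: p).
Proof.
move=> Uxp; rewrite mdeg_walk -(count_uniq_mem u Uxp) /=.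
have := congr1 (count_mem u) (lastI x p).
rewrite -cats1 count_cat /= [x == u]eq_sym [last x p == u]eq_sym; lia.
Qed.

Lemma walk_notin x p u v : u \notin x :: p -> walk x p u v = 0.
Proof.
elim: p x => //= y p IH x; rewrite inE negb_or => /andP[ux uyp].
rewrite IH // /edge (negbTE ux); move: uyp; rewrite inE negb_or.
by case/andP=> /negbTE->.
Qed.

Lemma edge_le (e : rel T) a c u v : symmetric e -> irreflexive e -> e a c ->
  edge a c u v <= e u v.
Proof.
move=> e_sym e_irr eac; rewrite /edge.
have ac : a != c by apply: contraTneq eac => ->; rewrite e_irr.
case: (boolP ((u == a) && (v == c))) => [/andP[/eqP-> /eqP->]|_].
  by rewrite (negbTE ac) eac.
case: (boolP ((u == c) && (v == a))) => [/andP[/eqP-> /eqP->]|//].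
by rewrite e_sym eac.
Qed.

(** On a path without repetition no edge is used twice: the first one contains [x], which never
    recurs. *)
Lemma walk_le (e : rel T) x p u v : symmetric e -> irreflexive e ->
  path e x p -> uniq (x :: p) -> walk x p u v <= e u v.
Proof.
move=> e_sym e_irr; elim: p x => //= y p IH x /andP[exy eyp] /andP[xp Up].
have leE := edge_le u v e_sym e_irr exy.
case: (posnP (walk y p u v)) => [->|w_gt0]; first by rewrite addn0.
suff -> : edge x y u v = 0 by rewrite add0n; exact: IH.
have uP : u \in y :: p by apply: contraLR w_gt0 => /walk_notin->.
have vP : v \in y :: p.
  by apply: contraLR w_gt0 => /walk_notin h; rewrite walkC h.
have nx t : t \in y :: p -> (t == x) = false.
  by move=> tp; apply: contraNF xp => /eqP<-.
by rewrite /edge (nx _ uP) (nx _ vP) andbF.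
Qed.

Definition rel_of m : rel T := fun u v => 0 < m u v.

Lemma degree_rel_of (e : rel T) m u :
  (forall v, m u v <= e u v) -> degree (rel_of m) u = mdeg m u.
Proof.
move=> le_me; rewrite /degree /mdeg -sum1_card big_mkcond /=.
apply: eq_bigr => v _; rewrite inE /rel_of.
by have := le_me v; case: (e u v); case: (m u v) => [|[|]].
Qed.

Lemma mdeg_rel (f : rel T) u : mdeg (fun x y => f x y : nat) u = degree f u.
Proof.
rewrite /degree /mdeg -sum1_card [RHS]big_mkcond; apply: eq_bigr => v _.
by rewrite inE; case: (f u v).
Qed.

End Multigraphs.

Ltac nlia :=
  clear; rewrite /=;
  repeat match goal with
  | |- context [nat_of_bool ?c] => move: (nat_of_bool c) => ?
  end; lia.

Lemma min_degree_le (T : finType) (e : rel T) x : min_degree e <= degree e x.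
Proof.
rewrite /min_degree; have : x \in index_enum T by exact: mem_index_enum.
elim: (index_enum T) => // y s IH; rewrite inE big_cons geq_min.
by case/predU1P=> [<-|/IH->]; rewrite ?leqnn ?orbT.
Qed.

(** At most one term is nonzero. This bounds the joint multiplicity of pairwise distinct edges or
    disjoint paths. *)
Lemma sum_le_cond (I : finType) (P : pred I) (F : I -> nat) k :
    (forall i j, P i -> P j -> 0 < F i -> 0 < F j -> i = j) ->
    (forall i, P i -> F i <= k) ->
  \sum_(i | P i) F i <= k.
Proof.
move=> F1 Fk; case: (pickP (fun i => P i && (0 < F i))) => [i /andP[Pi Fi]|F0].
  rewrite (bigD1 i) //= big1 ?addn0 ?Fk // => j /andP[Pj ji].
  by apply/eqP; rewrite eqn0Ngt; apply: contra ji => Fj; apply/eqP/F1.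
by rewrite big1 // => i Pi; apply/eqP; rewrite eqn0Ngt; have := F0 i;
  rewrite Pi => /= ->.
Qed.

(** * Extremal partial factors and the exchange principles *)

Section Extremal.

Variables (T : finType) (e : rel T) (b : nat).
Implicit Types (f : rel T) (u v w x y z h : T) (p : seq T).

Definition partial_factor f : bool :=
  [&& [forall u, forall v, f u v == f v u],
      [forall u, forall v, f u v ==> e u v]
    & [forall v, (degree f v == 0) || (2 <= degree f v <= b)]].

Lemma partial_factorP f :
  reflect [/\ symmetric f, subrel f e
            & forall v, (degree f v == 0) || (2 <= degree f v <= b)]
          (partial_factor f).
Proof.
apply: (iffP and3P) => -[h1 h2 h3]; split.
- by move=> u v; apply/eqP; move/forallP: h1 => /(_ u)/forallP/(_ v).
- by move=> u v; apply/implyP; move/forallP: h2 => /(_ u)/forallP/(_ v).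
- exact/forallP.
- by apply/forallP=> u; apply/forallP=> v; apply/eqP.
- by apply/forallP=> u; apply/forallP=> v; apply/implyP/h2.
- exact/forallP.
Qed.

Definition covered f : {set T} := [set v | 0 < degree f v].

(** The degree sum stands for twice the number of edges. *)
Definition extremal f : Prop :=
  partial_factor f /\
  forall f', partial_factor f' ->
    #|covered f'| <= #|covered f| /\
    (#|covered f'| = #|covered f| ->
       \sum_v degree f v <= \sum_v degree f' v).

Lemma eq_degree f f' : f =2 f' -> degree f =1 degree f'.
Proof. by move=> ff' v; apply: eq_card => w; rewrite !inE ff'. Qed.

(** Both criteria are merged into one potential: degree sums are at most [N], so one more covered
    vertex, weighted [N.+1], outweighs any change in the edges. Relations are coded as sets of
    pairs, which form a finite type. *)
Lemma exists_extremal : exists f, extremal f.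
Proof.
pose r (E : {set T * T}) : rel T := fun u v => (u, v) \in E.
pose N := #|T| * #|T|.
pose pot (E : {set T * T}) :=
  #|covered (r E)| * N.+1 + (N - \sum_v degree (r E) v).
have degN f : \sum_v degree f v <= N.
  by rewrite /N -sum_nat_const; apply: leq_sum => v _; exact: max_card.
have pf0 : partial_factor (r set0).
  apply/partial_factorP; split=> [u v|u v|v]; rewrite /r ?inE //.
  by apply/orP; left; apply/eqP/eq_card0 => w; rewrite !inE.
case: (@arg_maxnP _ set0 (fun E => partial_factor (r E)) pot pf0) => E pfE maxE.
exists (r E); split=> // f' /partial_factorP[f's f'e f'd].
pose E' := [set q : T * T | f' q.1 q.2].
have rE' : r E' =2 f' by move=> u v; rewrite /r inE.
have dE' := eq_degree rE'.
have cE' : covered (r E') = covered f' by apply/setP=> v; rewrite !inE dE'.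
have pfE' : partial_factor (r E').
  apply/partial_factorP; split=> [u v|u v|v]; rewrite ?rE' ?dE' //.
  exact: f'e.
have := maxE _ pfE'; rewrite /pot cE' (eq_bigr _ (fun v _ => dE' v)) => le_pot.
have := degN (r E); have := degN f'; split; nia.
Qed.

Hypotheses (e_sym : symmetric e) (e_irr : irreflexive e) (hb : 4 <= b).
Variable f : rel T.
Hypothesis f_ext : extremal f.

Local Notation W := (covered f).
Local Notation D := (degree f).
Local Notation fm := (fun u v => f u v : nat).

Let f_sym : symmetric f. Proof. by case: f_ext => /partial_factorP[]. Qed.
Let f_sub : subrel f e. Proof. by case: f_ext => /partial_factorP[]. Qed.

Lemma f_le u v : fm u v <= e u v.
Proof. by have := @f_sub u v; case: (f u v) => // ->. Qed.

Lemma f_irr u : f u u = false.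
Proof. by apply/negbTE; apply: contraFN (e_irr u); exact: f_sub. Qed.

Lemma degree_covered u : u \in W -> 2 <= D u <= b.
Proof.
rewrite inE; case: f_ext => /partial_factorP[_ _ /(_ u)] + _.
by case: (D u).
Qed.

Lemma degree_out u : u \notin W -> D u = 0.
Proof. by rewrite inE -eqn0Ngt => /eqP. Qed.

Lemma edge_covered u v : f u v -> u \in W.
Proof. by move=> fuv; rewrite inE card_gt0; apply/set0Pn; exists v;
  rewrite inE. Qed.

Lemma mdeg_f u : mdeg fm u = D u. Proof. exact: mdeg_rel. Qed.

Lemma exchange_factor m :
    (forall u v, m u v = m v u) -> (forall u v, m u v <= e u v) ->
    (forall u, (mdeg m u == 0) || (2 <= mdeg m u <= b)) ->
  partial_factor (rel_of m) /\ (forall u, degree (rel_of m) u = mdeg m u).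
Proof.
move=> m_sym m_le m_deg.
have dm u : degree (rel_of m) u = mdeg m u by exact: (degree_rel_of (m_le u)).
split=> //; apply/partial_factorP; split=> [u v|u v|v].
- by rewrite /rel_of m_sym.
- by rewrite /rel_of; have := m_le u v; case: (e u v) => //; case: (m u v).
- by rewrite dm.
Qed.

(** Otherwise the support of [m] would be a partial factor covering all of [W] and also [v0]. Degree
    2 outside [W] is what added ears and cycles produce. *)
Lemma no_gain m v0 :
    (forall u v, m u v = m v u) -> (forall u v, m u v <= e u v) ->
    (forall u, u \in W -> 2 <= mdeg m u <= b) ->
    (forall u, u \notin W -> (mdeg m u == 0) || (mdeg m u == 2)) ->
  v0 \notin W -> mdeg m v0 = 0.
Proof.
move=> m_sym m_le m_in m_out v0W.
have [u|pf dm] := exchange_factor m_sym m_le.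
  case: (boolP (u \in W)) => [/m_in->|/m_out]; first by rewrite orbT.
  by case/orP=> /eqP->; rewrite //= (leq_trans _ hb).
apply/eqP; rewrite eqn0Ngt; apply/negP => m_v0.
case: f_ext => _ /(_ _ pf)[le_cov _].
have : W \proper covered (rel_of m).
  apply/properP; split.
    by apply/subsetP=> u /m_in; rewrite !inE dm => /andP[/ltnW].
  by exists v0; rewrite // inE dm.
by move/proper_card; rewrite ltnNge le_cov.
Qed.

(** Such an [m] covers exactly [W], so the second criterion of extremality applies. *)
Lemma no_reduction m :
    (forall u v, m u v = m v u) -> (forall u v, m u v <= e u v) ->
    (forall u, u \in W -> 2 <= mdeg m u <= b) ->
    (forall u, u \notin W -> mdeg m u = 0) ->
  \sum_v D v <= \sum_v mdeg m v.
Proof.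
move=> m_sym m_le m_in m_out.
have [u|pf dm] := exchange_factor m_sym m_le.
  case: (boolP (u \in W)) => [/m_in->|/m_out->]; rewrite ?orbT //.
case: f_ext => _ /(_ _ pf)[_].
rewrite (eq_bigr _ (fun v _ => dm v)); apply; apply: eq_card => u.
rewrite [LHS]inE dm; case: (boolP (u \in W)) => [/m_in|/m_out->//].
by case/andP=> /ltnW->.
Qed.

(** * Ears through the uncovered vertices *)

(** Adjacency in G - W, kept as a relation on all of [T] so that its paths remain sequences in
    [T]. *)
Definition eC : rel T := [rel u v | [&& e u v, u \notin W & v \notin W]].

Lemma path_eC_out x p : x \notin W -> path eC x p ->
  {in x :: p, forall u, u \notin W}.
Proof.
elim: p x => [|y p IH] x xW /= => [_ u|]; first by rewrite inE => /eqP->.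
case/andP=> /and3P[_ _ yW] eyp u; rewrite inE => /predU1P[->//|].
exact: IH.
Qed.

Lemma path_eC_e x p : path eC x p -> path e x p.
Proof. by apply: sub_path => u v /and3P[]. Qed.

Lemma eC_sym : symmetric eC.
Proof. by move=> u v; rewrite /eC /= e_sym [(u \notin _) && _]andbC. Qed.

Lemma edge_out a c u v : u \in W -> v \in W -> c \notin W ->
  edge a c u v = 0.
Proof.
move=> uW vW cW; rewrite /edge.
have -> : (v == c) = false by apply: contraNF cW => /eqP<-.
have -> : (u == c) = false by apply: contraNF cW => /eqP<-.
by rewrite andbF.
Qed.

(* [m] is a modification of F inside W; adding to it the ear w1, x, ..., last,
   w2 through G - W would cover new vertices. *)
Lemma no_ear (m : T -> T -> nat) x p w1 w2 :
    (forall u v, m u v = m v u) -> (forall u v, m u v <= e u v) ->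
    (forall u v, u \notin W -> m u v = 0) ->
    x \notin W -> path eC x p -> uniq (x :: p) ->
    w1 \in W -> w2 \in W -> e w1 x -> e w2 (last x p) ->
    (w1 != w2) || (x != last x p) ->
    ~ (forall u, u \in W ->
         2 <= mdeg m u + (u == w1) + (u == w2) <= b).
Proof.
move=> m_sym m_le m_out xW exp Uxp w1W w2W ew1 ew2 neq m_deg.
have out := path_eC_out xW exp.
have lW : last x p \notin W by apply: out; exact: mem_last.
have neW u v : u \in W -> v \notin W -> (u == v) = false.
  by move=> uW vW; apply: contraNF vW => /eqP<-.
have neW' u v : u \in W -> v \notin W -> (v == u) = false.
  by move=> uW vW; rewrite eq_sym neW.
pose m' u v := m u v + (walk x p u v + (edge w1 x u v +
  edge w2 (last x p) u v)).
have dm' u : mdeg m' u =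
    mdeg m u + (mdeg (walk x p) u + ((u == w1) + (u == x) + ((u == w2) +
      (u == last x p)))).
  by rewrite /m' 3!mdegD !mdeg_edge.
have dw u := mdeg_uniq_walk u Uxp.
have walk0 u v : u \in W -> walk x p u v = 0.
  by move=> uW; apply/walk_notin/negP => /out; rewrite uW.
suff : mdeg m' x = 0.
  by have := dw x; rewrite dm' mem_head eqxx; nlia.
apply: (no_gain _ _ _ _ xW) => [u v|u v|u uW|u uW].
- by rewrite /m' m_sym walkC edgeC [edge w2 _ _ _]edgeC.
(* Between [W] and its complement only the two end edges of the ear occur; [neq] keeps them from
   being the same edge. *)
- have mix u' v' : u' \in W -> v' \notin W -> m' u' v' <= e u' v'.
    move=> uW vW; rewrite /m' m_sym m_out // walk0 // /edge.
    rewrite (neW' w1 v') // (neW' w2 v') // !andbF !addn0 !add0n.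
    case: (boolP ((u' == w1) && _)) => [/andP[/eqP-> /eqP->]|_].
      rewrite ew1; case: (boolP ((w1 == w2) && _)) => // /andP[w12 xl].
      by move: neq; rewrite w12 xl.
    by case: andP => // -[/eqP-> /eqP->]; rewrite ew2.
  case: (boolP (u \in W)) => uW; case: (boolP (v \in W)) => vW.
  + by rewrite /m' walk0 // !edge_out // !addn0.
  + exact: mix.
  + have -> : m' u v = m' v u.
      by rewrite /m' m_sym walkC edgeC [edge w2 _ _ _]edgeC.
    by rewrite e_sym; exact: mix.
  + rewrite /m' m_out // /edge (neW' w1 v) // (neW' w2 v) // (neW' w1 u) //.
    rewrite (neW' w2 u) // !andbF !addn0.
    by apply: walk_le => //; exact: path_eC_e.
- rewrite dm'; have := m_deg _ uW; have := dw u.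
  have /negbTE-> : u \notin x :: p by apply/negP => /out; rewrite uW.
  rewrite (neW _ x) // (neW _ (last x p)) //; nlia.
- rewrite dm' (neW' w1) // (neW' w2) //.
  have -> : mdeg m u = 0 by rewrite /mdeg big1 // => v _; exact: m_out.
  by have := dw u; case: (u \in x :: p) => /=; nlia.
Qed.


(** Adding the ear to F raises the degrees of [w1] and [w2] by one each, which is allowed if they
    differ. If they coincide the degree rises by two, which exceeds [b] only from [b.-1]. *)
Lemma low_ear x p w1 w2 :
    x \notin W -> path eC x p -> uniq (x :: p) -> w1 \in W -> w2 \in W ->
    e w1 x -> e w2 (last x p) -> D w1 < b -> D w2 < b ->
  w1 = w2 /\ (x != last x p -> D w1 = b.-1).
Proof.
move=> xW exp Uxp w1W w2W ew1 ew2 D1 D2.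
have noe : (w1 != w2) || (x != last x p) ->
    ~ (forall u, u \in W -> 2 <= D u + (u == w1) + (u == w2) <= b).
  move=> neq deg; apply: (no_ear (m := fm) _ _ _ xW exp Uxp w1W w2W) => //.
  - by move=> u v; rewrite f_sym.
  - exact: f_le.
  - by move=> u v uW; case fuv: (f u v) => //; rewrite (edge_covered fuv) in uW.
  - by move=> u uW; rewrite mdeg_f; exact: deg.
case: (eqVneq w1 w2) => [w12|w12].
  split=> // xl; apply/eqP/negPn/negP => D1b.
  apply: noe; first by rewrite xl orbT.
  move=> u uW; have := degree_covered uW; rewrite -w12.
  by case: (u =P w1) D1 D1b hb => [->|_]; nlia.
case: noe; rewrite ?w12 // => u uW; have := degree_covered uW.
case: (u =P w1) D1 => [->|_].
  by rewrite (negbTE w12); nlia.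
by case: (u =P w2) D2 => [->|_]; nlia.
Qed.

(** * Local structure forced by edge swaps *)

(** The witness is F without hy and h'y' but with yy': the degrees of [y] and [y'] are restored, and
    only [h] and [h'] lose. The additive form includes [h = h'], where the loss is two. *)
Lemma swap_edges h y h' y' :
    f h y -> f h' y' -> y != y' -> h != y' -> h' != y -> e y y' -> ~~ f y y' ->
  exists m : T -> T -> nat,
    [/\ forall u v, m u v = m v u, forall u v, m u v <= e u v,
        forall u v, u \notin W -> m u v = 0
      & forall u, mdeg m u + (u == h) + (u == h') = D u].
Proof.
move=> fhy fhy' yy' hy' h'y eyy' nfyy'.
have le1 u v := edge_le u v f_sym f_irr fhy.
have le2 u v := edge_le u v f_sym f_irr fhy'.
have le12 u v : edge h y u v + edge h' y' u v <= fm u v.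
  case: (posnP (edge h y u v)) => [->|gt1]; first by rewrite add0n.
  suff -> : edge h' y' u v = 0 by rewrite addn0.
  move: gt1; rewrite /edge addn_gt0 !lt0b.
  case/orP=> /andP[/eqP-> /eqP->].
    by rewrite (negbTE yy') (negbTE hy') andbF.
  by rewrite (negbTE yy') (negbTE hy') andbF.
have le3 u v := edge_le u v e_sym e_irr eyy'.
exists (fun u v => (fm u v - (edge h y u v + edge h' y' u v)) + edge y y' u v).
split=> [u v|u v|u v uW|u].
- by rewrite f_sym (edgeC h) (edgeC h') (edgeC y).
- case: (posnP (edge y y' u v)) => [->|gt3].
    by rewrite addn0 (leq_trans (leq_subr _ _)) // f_le.
  suff -> : f u v = false by rewrite sub0n le3.
  move: gt3; rewrite /edge addn_gt0 !lt0b; case/orP=> /andP[/eqP-> /eqP->].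
    exact: negbTE.
  by rewrite f_sym; exact: negbTE.
- have fu t : f u t -> False by move=> fut; rewrite (edge_covered fut) in uW.
  have -> : f u v = false by apply/negP => /fu.
  rewrite sub0n /edge; case: (u =P y) => [uy|_]; first by case: (fu h);
    rewrite uy f_sym.
  by case: (u =P y') => [uy|_] //; case: (fu h'); rewrite uy f_sym.
- rewrite mdegD mdegB; last by move=> v; exact: le12.
  rewrite mdegD !mdeg_edge mdeg_f.
  have : mdeg (fun x z => edge h y x z + edge h' y' x z) u <= D u.
    by rewrite -mdeg_f; apply: leq_sum => v _; exact: le12.
    by rewrite mdegD !mdeg_edge; nlia.
Qed.

(* Otherwise trade the edges hy and h'y' for yy' and the ear from h to h'. *)
Lemma ear_chord x p h h' y y' :
    x \notin W -> path eC x p -> uniq (x :: p) -> h \in W -> h' \in W ->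
    e h x -> e h' (last x p) -> (h != h') || (x != last x p) ->
    f h y -> f h' y' -> h != y' -> h' != y -> e y y' ->
  f y y'.
Proof.
move=> xW exp Uxp hW h'W ehx eh'x neq fhy fhy' hy' h'y eyy'.
have yy' : y != y' by apply: contraTneq eyy' => ->; rewrite e_irr.
apply/negPn/negP => nf.
have [m [m1 m2 m3 m4]] := swap_edges fhy fhy' yy' hy' h'y eyy' nf.
apply: (no_ear m1 m2 m3 xW exp Uxp hW h'W ehx eh'x neq) => u uW.
by rewrite m4; exact: degree_covered.
Qed.

(** Trading hy and hy' for yy' would save an edge, and [h] would keep degree at least 2. *)
Lemma high_chord h y y' : 4 <= D h -> f h y -> f h y' -> e y y' -> f y y'.
Proof.
move=> Dh fhy fhy' eyy'.
have yy' : y != y' by apply: contraTneq eyy' => ->; rewrite e_irr.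
have hy : h != y by apply: contraTneq fhy => ->; rewrite f_irr.
have hy' : h != y' by apply: contraTneq fhy' => ->; rewrite f_irr.
apply/negPn/negP => nf.
have [m [m1 m2 m3 m4]] := swap_edges fhy fhy' yy' hy' hy eyy' nf.
have : \sum_v D v <= \sum_v mdeg m v.
  apply: no_reduction => // u uW; last by rewrite /mdeg big1 // => v _;
    exact: m3.
  have := m4 u; have := degree_covered uW.
  by case: (u =P h) Dh => [->|_]; nlia.
rewrite leqNgt => /negP[].
rewrite [ltnRHS](eq_bigr _ (fun u _ => esym (m4 u))) !big_split /=.
by rewrite [X in _ < _ + X](bigD1 h) //= eqxx; nlia.
Qed.

(** If both ends of hy had degree at least 3, the edge could simply be deleted. *)
Lemma degree_nbr h y : 3 <= D h -> f h y -> D y = 2.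
Proof.
move=> Dh fhy; have yW : y \in W by apply: (@edge_covered y h); rewrite f_sym.
have hy : h != y by apply: contraTneq fhy => ->; rewrite f_irr.
apply/eqP; rewrite eqn_leq andbC; case/andP: (degree_covered yW) => -> _ /=.
rewrite leqNgt; apply/negP => Dy.
have leE u v := edge_le u v f_sym f_irr fhy.
pose m u v := fm u v - edge h y u v.
have dm u : mdeg m u + (u == h) + (u == y) = D u.
  rewrite mdegB // mdeg_f mdeg_edge -addnA subnK //.
  by rewrite -mdeg_edge -mdeg_f; apply: leq_sum => v _.
have : \sum_v D v <= \sum_v mdeg m v.
  apply: no_reduction => [u v|u v|u uW|u uW].
  - by rewrite /m f_sym edgeC.
  - by rewrite (leq_trans (leq_subr _ _)) // f_le.
  - have := dm u; have := degree_covered uW; case: (u =P h) Dh => [->|_].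
      by rewrite (negbTE hy); nlia.
    by case: (u =P y) Dy => [->|_]; nlia.
  - by have := dm u; rewrite degree_out //; nlia.
rewrite leqNgt => /negP[].
rewrite [ltnRHS](eq_bigr _ (fun u _ => esym (dm u))) !big_split /=.
by rewrite [X in _ < _ + X](bigD1 y) //= eqxx; nlia.
Qed.


(** * The forest G - W and its leaves *)

(** A cycle of G - W could be added to F as a new component. *)
Lemma no_cycle x p :
  path eC x p -> uniq (x :: p) -> 2 <= size p -> ~~ e (last x p) x.
Proof.
case: p => // y p exp Uxp sz; apply/negP; rewrite [last _ _]/=.
set l := last y p => elx.
have xW : x \notin W by case/andP: exp => /and3P[].
have out := path_eC_out xW exp.
have [xyp Uyp] : x \notin y :: p /\ uniq (y :: p) by apply/andP.
have exy : e x y by case/andP: exp => /and3P[].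
have eyp : path eC y p by case/andP: exp.
have neyl : y != l.
  rewrite /l; case: (p) sz Uyp => //= t p' _ /andP[ytp _].
  by apply: contraNneq ytp => {1}->; exact: mem_last.
have neW u v : u \in W -> v \notin W -> (u == v) = false.
  by move=> uW vW; apply: contraNF vW => /eqP<-.
have xl : x != l by apply: contraNneq xyp => ->; exact: mem_last.
have xy : x != y by apply: contraNneq xyp => ->; exact: mem_head.
(* The cycle is the path from [y] to [l] together with the two edges at [x], which are distinct by
   [neyl]. *)
pose m u v := fm u v + (walk y p u v + (edge x y u v + edge x l u v)).
have m_sym u v : m u v = m v u.
  by rewrite /m f_sym walkC edgeC [edge x l _ _]edgeC.
have lW : l \notin W by apply: out; rewrite inE mem_last orbT.
have yW : y \notin W by apply: out; rewrite !inE eqxx orbT.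
have dm u : mdeg m u = D u + 2 * (u \in x :: y :: p).
  rewrite /m 3!mdegD mdeg_f !mdeg_edge; have := mdeg_uniq_walk u Uyp.
  rewrite -/l [u \in x :: _]in_cons; case: (u =P x) => [->|_];
    last by rewrite /=; nlia.
  by rewrite (negbTE xyp) /=; nlia.
suff : mdeg m x = 0 by rewrite dm mem_head; nlia.
apply: (no_gain m_sym _ _ _ xW) => [u v|u uW|u uW]; last 2 first.
- have -> : mdeg m u = D u.
    by rewrite dm; case: (boolP (u \in _)) => [/out|]; rewrite ?uW ?addn0.
  exact: degree_covered.
- by rewrite dm degree_out //; case: (u \in _).
have inx v' : m x v' <= e x v'.
  have -> : m x v' = (v' == y) + (v' == l).
    rewrite /m walk_notin // /edge eqxx (negbTE xl) (negbTE xy) !addn0.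
    case fxv: (f x v') => //; by rewrite (edge_covered fxv) in xW.
  case: (v' =P y) => [->|_]; first by rewrite (negbTE neyl) exy.
  by case: (v' =P l) => [->|_] //; rewrite e_sym elx.
case: (u =P x) => [->|/eqP ux]; first exact: inx.
case: (v =P x) => [->|/eqP vx]; first by rewrite m_sym e_sym.
have -> : m u v = fm u v + walk y p u v.
  by rewrite /m /edge (negbTE ux) (negbTE vx) !andbF !addn0.
case fuv: (f u v); last by apply: walk_le => //; exact: path_eC_e.
rewrite walk_notin ?addn0 ?(f_sub fuv) //; apply/negP => uyp.
by have := out u; rewrite (edge_covered fuv) inE uyp orbT => /(_ isT).
Qed.

Definition outs x := [set u | eC x u].

(** As G - W is a forest, a path that cannot be prolonged ends in a leaf or, when it is trivial, in
    an isolated vertex. *)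
Lemma exists_leaf z : z \notin W ->
  exists p, [/\ path eC z p, uniq (z :: p), #|outs (last z p)| <= 1
              & (z != last z p) || (#|outs (last z p)| == 0)].
Proof.
move=> zW.
(* [n] bounds the prolongations still possible, since a path without repetition has at most [#|T|]
   vertices. *)
have ext n : forall p, #|T| <= n + size p -> path eC z p -> uniq (z :: p) ->
  exists p, [/\ path eC z p, uniq (z :: p), #|outs (last z p)| <= 1
              & (z != last z p) || (#|outs (last z p)| == 0)].
  elim: n => [|n IH] p szp ezp Up.
    by have := max_card (mem (z :: p));
      rewrite (card_uniqP Up) /= leqNgt ltnS szp.
  case: (boolP [exists u, eC (last z p) u && (u \notin z :: p)]).
    case/existsP=> u /andP[elu up]; apply: (IH (rcons p u)).
    - by rewrite size_rcons addnS -addSn.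
    - by rewrite rcons_path ezp.
    - by rewrite -rcons_cons rcons_uniq up.
  rewrite negb_exists => /forallP no_ext; exists p; split=> //; last first.
    case/lastP: p {szp ezp} Up no_ext => [|p x] Up no_ext.
      rewrite eqxx cards_eq0; apply/eqP/setP=> u; rewrite !inE.
      have := no_ext u; rewrite negb_and negbK inE.
      by case/orP=> [/negbTE//|/eqP->]; rewrite /eC /= e_irr.
    rewrite last_rcons; apply/orP; left; apply: contraTneq Up => ->.
    by rewrite cons_uniq mem_rcons mem_head.
  case/lastP: p {szp} ezp Up no_ext => [|p x] ezp Up no_ext.
    rewrite [X in X <= _](_ : _ = 0) //; apply: eq_card0 => u; rewrite !inE.
    have := no_ext u; rewrite negb_and negbK inE.
    by case/orP=> [/negbTE//|/eqP->]; rewrite /eC /= e_irr.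
  rewrite -(cards1 (last z p)); apply: subset_leq_card; apply/subsetP=> u.
  rewrite !inE => eCxu; have := no_ext u; rewrite last_rcons in eCxu *.
  rewrite eCxu /= negbK -rcons_cons mem_rcons inE => /predU1P[ux|uzp].
    by move: eCxu; rewrite ux /eC /= e_irr.
  case: (boolP (u == last z p)) => // ul.
  (* A neighbour [u] on the path other than the predecessor of [x] would close the segment from [u]
     to [x] into a cycle. *)
  case/splitPl: uzp ezp Up ul => p1 p2 lu.
  rewrite rcons_cat cat_path lu => /andP[_ eup2] Up ul.
  have : ~~ e (last u (rcons p2 x)) u.
    apply: (no_cycle eup2); last first.
      rewrite size_rcons ltnS; case: p2 ul {eup2 Up} => //.
      by rewrite cats0 lu eqxx.
    by move: Up; rewrite -cat_cons lastI lu cat_rcons cat_uniq; case/and3P.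
  by rewrite last_rcons; case/and3P: eCxu => ->.
by apply: (ext #|T| [::]) => //=; rewrite addn0.
Qed.

(** * Saturated neighbours and rich vertices *)

Definition high x := [set h in W | e x h & D h == b].
Definition low x := [set h in W | e x h & D h < b].

Lemma in_high x h : (h \in high x) = [&& h \in W, e x h & D h == b].
Proof. by rewrite inE. Qed.

Lemma in_low x h : (h \in low x) = [&& h \in W, e x h & D h < b].
Proof. by rewrite inE. Qed.

Lemma card_high_low x : x \notin W ->
  min_degree e <= #|high x| + #|low x| + #|outs x|.
Proof.
move=> xW; apply: leq_trans (min_degree_le e x) _; rewrite /degree.
apply: leq_trans (_ : #|high x :|: low x :|: outs x| <= _).
  apply/subset_leq_card/subsetP=> u; rewrite inE => exu.
  rewrite !in_setU in_high in_low [u \in outs x]inE exu /= /eC /= exu xW.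
  case: (boolP (u \in W)) => [uW|_] //=.
  by have /andP[_] := degree_covered uW; rewrite leq_eqVlt => /orP[->|->];
    rewrite ?orbT.
by rewrite (leq_trans (leq_card_setU _ _)) // leq_add2r leq_card_setU.
Qed.

(** The ear here is the single vertex [x] between two low neighbours. *)
Lemma card_low x : x \notin W -> #|low x| <= 1.
Proof.
move=> xW; apply/card_le1_eqP => w1 w2; rewrite !in_low.
case/and3P=> w1W ew1 D1 /and3P[w2W ew2 D2].
by have [] := @low_ear x [::] _ _ xW isT isT w1W w2W _ _ D1 D2; rewrite 1?e_sym.
Qed.

(** At a leaf other than [z], a low neighbour would give an ear from [y] and force [D y = b.-1], so
    only the one edge of the tree is lost. If [z] is isolated in G - W, only its at most one low
    neighbour is lost. *)
Lemma rich_end z y : z \notin W -> y \in W -> e z y -> D y <= b - 2 ->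
  exists p, [/\ path eC z p, uniq (z :: p)
              & min_degree e - 1 <= #|high (last z p)|].
Proof.
move=> zW yW ezy Dy; have [p [ezp Uzp out1 leaf]] := exists_leaf zW.
exists p; split=> //; set x := last z p in leaf out1 *.
have xW : x \notin W by apply: (path_eC_out zW ezp); exact: mem_last.
have := card_high_low xW; have := card_low xW.
case/orP: leaf => [zx|/eqP-> ]; last by lia.
suff -> : #|low x| = 0 by lia.
apply/eqP; rewrite cards_eq0; apply/set0Pn => -[w];
  rewrite in_low => /and3P[wW exw Dw].
have [] := low_ear zW ezp Uzp yW wW _ _ _ Dw; rewrite 1?e_sym //; first by lia.
by move=> _ /(_ zx); lia.
Qed.

(* The degree sum may fall one short of b (delta - 1), because
   ceil((k - 1) / 2) = floor(k / 2). *)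
Definition rich x (H : {set T}) :=
  [/\ x \notin W, forall h, h \in H -> [/\ h \in W, e x h & 3 <= D h],
      b * (min_degree e - 1) <= \sum_(h in H) D h + 1
    & forall h y y', h \in H -> f h y -> f h y' -> e y y' -> f y y'].

Lemma rich_high x : x \notin W -> min_degree e - 1 <= #|high x| ->
  rich x (high x).
Proof.
move=> xW hx; split=> // [h||h y y'].
- by rewrite in_high => /and3P[-> -> /eqP->]; split=> //; exact: ltnW.
- rewrite (eq_bigr (fun=> b)) => [|h];
    last by rewrite in_high => /and3P[_ _ /eqP].
  by rewrite sum_nat_const; nia.
- by rewrite in_high => /and3P[_ _ /eqP Dh]; apply: high_chord; rewrite Dh.
Qed.

(** Two leaves [x], [x'] of one tree are compared. If either has no low neighbour, or the tree is a
    single vertex, that vertex is rich through its saturated neighbours. *)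
Lemma exists_rich z : z \notin W -> exists x H, rich x H.
Proof.
move=> zW; have [p0 [ep0 _ out1 _]] := exists_leaf zW.
move: out1; set x := last z p0 => out1.
have xW : x \notin W by apply: (path_eC_out zW ep0); exact: mem_last.
have [p [exp Uxp out2 leaf]] := exists_leaf xW.
set x' := last x p in leaf out2.
have x'W : x' \notin W by apply: (path_eC_out xW exp); exact: mem_last.
have := card_high_low xW; have := card_low xW.
have := card_high_low x'W; have := card_low x'W.
case/orP: leaf => [xx'|/eqP-> ? ? _ _]; last first.
  by exists x', (high x'); apply: rich_high => //; lia.
case: (set_0Vmem (low x')) => [->|[w' w'low]].
  by rewrite cards0 => ? ? _ _; exists x', (high x'); apply: rich_high => //;
    lia.
case: (set_0Vmem (low x)) => [->|[w wlow]].
  by rewrite cards0 => _ _ ? ?; exists x, (high x); apply: rich_high => //; lia.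
move=> _ _ low1 card_x.
move: w'low wlow; rewrite !in_low => /and3P[w'W ew' Dw'] /and3P[wW ew Dw].
have [] := low_ear xW exp Uxp wW w'W _ _ Dw Dw'; rewrite 1?e_sym //.
(* Both ends of a path of G - W see the same vertex w of degree b - 1: w then
   replaces one neighbour of degree b. *)
move=> w_w' /(_ xx') Dwb; subst w'.
exists x, (w |: high x); split=> // [h||h y y'].
- rewrite in_setU1 in_high => /predU1P[->|/and3P[-> -> /eqP->]];
    last by split=> //; exact: ltnW.
  by split=> //; rewrite Dwb; case: (b) hb => // [].
(* There are at least delta - 2 saturated neighbours; [w] adds b - 1, which is where the sum falls
   one short. *)
- rewrite big_setU1 /=; last by rewrite in_high Dwb wW ew; move: hb; nlia.
  rewrite (eq_bigr (fun=> b)) => [|h];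
    last by rewrite in_high => /and3P[_ _ /eqP].
  by rewrite sum_nat_const Dwb; move: hb low1 card_x out1; clear; nia.
- rewrite in_setU1 in_high => /predU1P[->|]; last by case/and3P=> _ _ /eqP Dh;
    apply: high_chord; rewrite Dh.
  (* [D w] may be only 3, too small for [high_chord]; the path from [x] to [x'] is used instead, as
     an ear with both ends at [w]. *)
  move=> fwy fwy' eyy'.
  have neq t : f w t -> w != t by move=> fwt; apply: contraTneq fwt => <-;
    rewrite f_irr.
  apply: (ear_chord xW exp Uxp wW wW _ _ _ fwy fwy' _ _ eyy').
  + by rewrite e_sym.
  + by rewrite e_sym.
  + by rewrite xx' orbT.
  + exact: neq.
  + exact: neq.
Qed.


(** * A large independent set among the F-neighbours *)

Definition nbrs (H : {set T}) := [set y | [exists h in H, f h y]].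

Lemma nbrsP (H : {set T}) y :
  reflect (exists2 h, h \in H & f h y) (y \in nbrs H).
Proof. by rewrite inE; apply: exists_inP. Qed.

Lemma nbrs_rich x H y : rich x H -> y \in nbrs H ->
  [/\ y \in W, D y = 2 & y \notin H].
Proof.
move=> [_ Hh _ _] /nbrsP[h hH fhy]; have [_ _ Dh] := Hh h hH.
have Dy := degree_nbr Dh fhy; split=> //.
  by apply: (@edge_covered y h); rewrite f_sym.
by apply/negP => /Hh[_ _]; rewrite Dy.
Qed.

(** With a common neighbour in [H] this is the chord clause of [rich]; otherwise [x] alone is an ear
    between the two neighbours. *)
Lemma nbrs_edge x H y y' : rich x H -> y \in nbrs H -> y' \in nbrs H ->
  e y y' -> f y y'.
Proof.
move=> xH yN y'N eyy'.
have [_ _ yH] := nbrs_rich xH yN; have [_ _ y'H] := nbrs_rich xH y'N.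
case: xH => xW Hh _ chord; case/nbrsP: yN => h hH fhy.
case/nbrsP: y'N => h' h'H fh'y'.
case: (eqVneq h h') => [hh'|hh'].
  by apply: (chord h) => //; rewrite hh'.
have [hW exh _] := Hh h hH; have [h'W exh' _] := Hh h' h'H.
apply: (@ear_chord x [::] h h') => //=; rewrite ?hh' 1?e_sym //.
- by apply: contraNneq y'H => <-.
- by apply: contraNneq yH => <-.
Qed.

(** Degree sums become cardinals of sets of directed edges, to be compared by an injection. *)
Lemma sum_degree (H : {set T}) :
  \sum_(h in H) D h = #|[set q : T * T | (q.1 \in H) && f q.1 q.2]|.
Proof.
rewrite -sum1_card (eq_bigl (fun q : T * T => (q.1 \in H) && f q.1 q.2));
  last first.
  by move=> q; rewrite inE.
rewrite -(pair_big_dep (mem H) (fun h y => f h y) (fun _ _ => 1)) /=.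
by apply: eq_bigr => h _; rewrite sum1_card; apply: eq_card => y; rewrite inE.
Qed.

(** [Y] is a maximal F-independent subset of [nbrs H], independent in G by [nbrs_edge]. Its vertices
    have F-degree 2, so [2 * #|Y|] counts the directed edges leaving [Y], into which those leaving
    [H] are injected. *)
Lemma independent_nbrs x H : rich x H ->
  exists Y : {set T}, [/\ Y \subset nbrs H, independent e Y
                        & \sum_(h in H) D h <= 2 * #|Y|].
Proof.
move=> xH; pose P (Y : {set T}) := (Y \subset nbrs H) && independent f Y.
have P0 : P set0.
  by rewrite /P sub0set; apply/forall_inP => y; rewrite inE.
have [Y /maxsetP[/andP[YN Yf] Ymax] _] := maxset_exists P0.
have YfP y y' : y \in Y -> y' \in Y -> f y y' = false.
  by move=> yY y'Y; apply/negbTE;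
    move/forall_inP: Yf => /(_ y yY)/forall_inP/(_ y' y'Y).
exists Y; split=> //.
  apply/forall_inP => y yY; apply/forall_inP => y' y'Y.
  apply: contraFN (YfP y y' yY y'Y).
  by apply: (nbrs_edge xH); apply: (subsetP YN).
have dom y : y \in nbrs H -> y \notin Y -> exists2 y', y' \in Y & f y y'.
  move=> yN yY; apply/exists_inP; apply: contraNT yY; rewrite negb_exists_in.
  move=> /forall_inP nf; rewrite -(Ymax (y |: Y)) ?setU11 ?subsetUr //.
  rewrite /P subUset sub1set yN YN; apply/forall_inP => u uY.
  apply/forall_inP => v vY; move: uY vY; rewrite !in_setU1.
  case/predU1P=> [->|uY]; case/predU1P=> [->|vY].
  - by rewrite f_irr.
  - exact: nf.
  - by rewrite f_sym; exact: nf.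
  - by rewrite YfP.
(* By [dom], the default is never taken on [nbrs H] outside [Y]. *)
pose s y := odflt y [pick y' in Y | f y y'].
have sP y : y \in nbrs H -> y \notin Y -> s y \in Y /\ f y (s y).
  move=> yN yY; rewrite /s; case: pickP => [y' /andP[]//|none].
  by have [y' y'Y fyy'] := dom y yN yY; have := none y'; rewrite y'Y fyy'.
have inN h y : h \in H -> f h y -> y \in nbrs H by move=> hH fhy; apply/nbrsP;
  exists h.
have -> : 2 * #|Y| = \sum_(y in Y) D y.
  rewrite (eq_bigr (fun=> 2)) ?sum_nat_const 1?mulnC // => y yY.
  by have [] := nbrs_rich xH (subsetP YN y yY).
rewrite !sum_degree.
(* An edge hy with y outside Y is charged to the edge from the neighbour of y
   in Y. *)
pose phi (q : T * T) := if q.2 \in Y then (q.2, q.1) else (s q.2, q.2).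
set A := [set _ | _]; set B := [set _ | _].
have phi_inj : {in A &, injective phi}.
  move=> [h y] [h' y']; rewrite !inE /= => /andP[hH fhy] /andP[h'H fh'y'].
  have yN := inN _ _ hH fhy; have y'N := inN _ _ h'H fh'y'.
  have [_ _ yH] := nbrs_rich xH yN; have [_ _ y'H] := nbrs_rich xH y'N.
  rewrite /phi /=; case: ifP => yY; case: ifP => y'Y [].
  - by move=> -> ->.
  - by move=> _ hy'; rewrite -hy' hH in y'H.
  - by move=> _ yh'; rewrite yh' h'H in yH.
  (* If [h] and [h'] differed, then [h], [h'] and [s y] would be three F-neighbours of [y], which
     has degree 2. *)
  - move=> _ yy'; rewrite -yy' in fh'y' *; congr (_, _).
    have [syY fys] := sP y yN (negbT yY).
    have [_ Dy _] := nbrs_rich xH yN.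
    have [_ _ sH] := nbrs_rich xH (subsetP YN _ syY).
    apply/eqP; apply: contraPT (leqnn 2) => hh'; apply/negP.
    rewrite -ltnNge -{2}Dy -[3]/(3) /degree.
    have <- : #|[set h; h'; s y]| = 3.
      have nes t : t \in H -> t != s y by move=> tH; apply: contraNneq sH => <-.
      by rewrite -setUA !cardsU1 cards1 !inE !negb_or hh' !nes.
    apply/subset_leq_card/subsetP => t; rewrite !inE -orbA.
    by case/or3P=> /eqP->; rewrite // f_sym.
rewrite -(card_in_imset phi_inj); apply/subset_leq_card/subsetP => r.
case/imsetP=> -[h y]; rewrite !inE /= => /andP[hH fhy] ->.
have yN := inN _ _ hH fhy; rewrite /phi /=; case: ifP => yY /=.
  by rewrite yY f_sym.
have [-> fys] := sP y yN (negbT yY).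
by rewrite f_sym.
Qed.

(** The set [Y] of [independent_nbrs] lies in [W], hence is disjoint from [S], and no edge joins the
    two; so [S :|: Y] is independent. *)
Lemma indep_bound x H : rich x H ->
    (forall z y, z \notin W -> y \in nbrs H -> ~~ e z y) ->
  forall S : {set T}, S \subset ~: W -> independent e S ->
    #|S| + (b * (min_degree e - 1)) %/ 2 <= indep_num e.
Proof.
move=> xH sink S SW Sind.
have [Y [YN Yind cardY]] := independent_nbrs xH.
have SY : [disjoint S & Y].
  apply/pred0P => u /=; apply/negP => /andP[uS /(subsetP YN)uN].
  by have [uW _ _] := nbrs_rich xH uN; have := subsetP SW u uS;
    rewrite in_setC uW.
have nSY u v : u \in S -> v \in Y -> ~~ e u v.
  move=> uS vY; apply: sink; last exact: (subsetP YN).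
  by rewrite -in_setC; apply: (subsetP SW).
apply: leq_trans (_ : #|S :|: Y| <= _).
  rewrite cardsU disjoint_setI0 // cards0 subn0 leq_add2l.
  by case: xH => _ _ le_sum _; move: le_sum cardY; clear; lia.
apply: leq_bigmax_cond; apply/forall_inP => u uSY; apply/forall_inP => v vSY.
move: uSY vSY; rewrite !in_setU => /orP[uS|uY] /orP[vS|vY].
- by move/forall_inP: Sind => /(_ u uS)/forall_inP/(_ v vS).
- exact: nSY.
- by rewrite e_sym; exact: nSY.
- by move/forall_inP: Yind => /(_ u uY)/forall_inP/(_ v vY).
Qed.


(** * Attached vertices and the cyclic exchange *)

(** Since [nbrs H] consists of vertices of F-degree 2 for every rich pair, any uncovered vertex with
    a neighbour in [nbrs H] is attached. *)
Definition attached :=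
  [set z | (z \notin W) && [exists y in W, e z y && (D y == 2)]].

Lemma attachedP z :
  reflect (z \notin W /\ exists y, [/\ y \in W, e z y & D y = 2])
          (z \in attached).
Proof.
apply: (iffP idP); rewrite [_ \in attached]in_set.
  by case/andP=> zW /exists_inP[y yW /andP[ezy /eqP Dy]]; split=> //; exists y.
case=> zW [y [yW ezy Dy]]; rewrite zW.
by apply/exists_inP; exists y; rewrite // ezy Dy eqxx.
Qed.

(** Two attached vertices in one tree would be the ends of an ear between vertices of degree 2, so
    that [low_ear] would give 2 = b - 1. *)
Lemma attached_connect z z' : z \in attached -> z' \in attached ->
  connect eC z z' -> z = z'.
Proof.
case/attachedP=> zW [y [yW ezy Dy]] /attachedP[_ [y' [y'W ez'y' Dy']]].
case/connectP=> p0 ep0 z'p0; move: z'p0 ez'y';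
  case/shortenP: ep0 => p ezp Up _ ->.
move=> ez'y'; have [] := low_ear zW ezp Up yW y'W _ _ _ _;
  rewrite 1?e_sym ?Dy ?Dy' ?(leq_trans _ hb) //.
move=> _ zl; apply/eqP/negPn/negP => /zl; move: hb; clear; lia.
Qed.

(* For z in O: the path z, q z runs to X z inside one tree of G - W, h z is a
   neighbour of X z, and y z is an F-neighbour of h z adjacent to g z.
   Replacing the edges (h z)(y z) by the paths h z, X z, ..., z, y (g^-1 z)
   keeps the degrees on W. *)
Section CyclicExchange.

Variables (q : T -> seq T) (h y g : T -> T) (O : {set T}).
Hypothesis O_att : O \subset attached.
Hypothesis q_path : forall z, z \in O -> path eC z (q z) /\ uniq (z :: q z).
Hypothesis hP : forall z, z \in O -> h z \in high (last z (q z)).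
Hypothesis fhy : forall z, z \in O -> f (h z) (y z).
Hypothesis gP : forall z, z \in O -> g z \notin W /\ e (g z) (y z).
Hypothesis yg : {in O &, forall z z', y z = y z' -> g z = g z'}.
Hypothesis gO : g @: O = O.

Let X z := last z (q z).

(** The paths lie in different trees, so they are disjoint. As [g] permutes [O], each path gets one
    new edge at each end, so all its vertices have degree 2 and [W] would grow. *)
Lemma no_cyclic_exchange : O = set0.
Proof.
apply/setP => z0; rewrite in_set0; apply/negP => z0O.
have att z : z \in O -> z \in attached by exact: (subsetP O_att).
have outO z : z \in O -> z \notin W by move=> /att/attachedP[].
have q_out z u : z \in O -> u \in z :: q z -> u \notin W.
  by move=> zO; have [ezq _] := q_path zO; exact: (path_eC_out (outO z zO) ezq).
have XW z : z \in O -> X z \notin W by move=> zO; apply: (q_out z _ zO);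
  exact: mem_last.
have g_inj : {in O &, injective g} by apply/imset_injP; rewrite gO.
have q_disj z z' u : z \in O -> z' \in O -> u \in z :: q z ->
  u \in z' :: q z' -> z = z'.
  move=> zO z'O uz uz'; apply: attached_connect; rewrite ?att //.
  have [ezq _] := q_path zO; have [ez'q _] := q_path z'O.
  apply: (connect_trans (path_connect ezq uz)).
  by rewrite (sym_connect_sym eC_sym); exact: (path_connect ez'q uz').
have hD z : z \in O -> [/\ h z \in W, e (h z) (X z) & D (h z) = b].
  by move=> /hP; rewrite in_high e_sym => /and3P[? ? /eqP].
have yD z : z \in O -> y z \in W /\ D (y z) = 2.
  move=> zO; have [_ _ Dh] := hD z zO; split.
    by apply: (@edge_covered _ (h z)); rewrite f_sym fhy.
  by apply: (degree_nbr _ (fhy zO)); rewrite Dh ltnW.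
have hy z z' : z \in O -> z' \in O -> h z != y z'.
  move=> zO z'O; have [_ _ Dh] := hD z zO; have [_ Dy] := yD z' z'O.
  by apply: contraTneq hb => hy; rewrite -Dh hy Dy.
(* [g z] depends only on [y z], so injectivity passes from [g] to [y]: the deleted edges are
   distinct. *)
have y_inj : {in O &, injective y}.
  by move=> z z' zO z'O yz; apply: g_inj => //; exact: yg.
have neW u v : u \in W -> v \notin W -> (u == v) = false.
  by move=> uW vW; apply: contraNF vW => /eqP<-.
have neW' u v : u \in W -> v \notin W -> (v == u) = false.
  by move=> uW vW; rewrite eq_sym neW.
pose old u v := \sum_(z in O) edge (h z) (y z) u v.
pose new z u v :=
  walk z (q z) u v + (edge (h z) (X z) u v + edge (y z) (g z) u v).
pose m u v := (fm u v - old u v) + \sum_(z in O) new z u v.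
have old_le u v : old u v <= fm u v.
  apply: sum_le_cond => [z z' zO z'O|z zO];
    last exact: (edge_le _ _ f_sym f_irr (fhy zO)).
  rewrite /edge !addn_gt0 !lt0b =>
    /orP[]/andP[/eqP uz /eqP vz] /orP[]/andP[/eqP uz' /eqP vz'].
  - by apply: y_inj => //; rewrite -vz -vz'.
  - by have := hy z z' zO z'O; rewrite -uz -uz' eqxx.
  - by have := hy z' z z'O zO; rewrite -uz -uz' eqxx.
  - by apply: y_inj => //; rewrite -uz -uz'.
have m_sym u v : m u v = m v u.
  rewrite /m f_sym /old; congr (_ - _ + _); apply: eq_bigr => z _.
    exact: edgeC.
  by rewrite /new walkC edgeC [edge (y z) _ _ _]edgeC.
have f_out u v : u \notin W -> f u v = false.
  by apply: contraNF => fuv; exact: edge_covered fuv.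
have gW z : z \in O -> g z \notin W by move=> /gP[].
have walk0 z u v : z \in O -> u \in W -> walk z (q z) u v = 0.
  by move=> zO uW; apply/walk_notin/negP => /(q_out z u zO); rewrite uW.
have dm u : mdeg m u = D u - \sum_(z in O) ((u == h z) + (u == y z)) +
    \sum_(z in O) (mdeg (walk z (q z)) u +
      ((u == h z) + (u == X z) + ((u == y z) + (u == g z)))).
  rewrite /m mdegD mdegB // mdeg_f /old !mdeg_sum; congr (_ - _ + _).
    by apply: eq_bigr => z _; rewrite mdeg_edge.
  by apply: eq_bigr => z _; rewrite /new 2!mdegD !mdeg_edge.
have dout u : u \notin W -> mdeg m u = \sum_(z in O) 2 * (u \in z :: q z).
  move=> uW; rewrite dm degree_out // sub0n add0n.
  rewrite (eq_bigr (fun z =>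
    (mdeg (walk z (q z)) u + (u == X z)) + (u == g z))).
    (* Reindexing along [g] turns the terms for [g z] into terms for the starting points [z]. *)
    rewrite big_split /= -(big_imset (fun t => (u == t) : nat) g_inj) gO.
    rewrite -big_split /=; apply: eq_bigr => z zO.
    have [_ Uq] := q_path zO; have := mdeg_uniq_walk u Uq.
    by rewrite -/(X z); nlia.
  move=> z zO; have [hW _ _] := hD z zO; have [yW _] := yD z zO.
  by rewrite (neW' (h z)) // (neW' (y z)) // add0n addnA.
suff : mdeg m z0 = 0.
  by rewrite dout ?outO // (bigD1 z0) //= mem_head.
apply: (no_gain m_sym _ _ _ (outO _ z0O)) => [u v|u uW|u uW]; last 2 first.
- suff -> : mdeg m u = D u by exact: degree_covered.
  rewrite dm [X in _ + X](eq_bigr (fun z => (u == h z) + (u == y z))).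
    apply: subnK; rewrite -mdeg_f.
    have <- : mdeg old u = \sum_(z in O) ((u == h z) + (u == y z)).
      by rewrite mdeg_sum; apply: eq_bigr => z _; exact: mdeg_edge.
    by apply: leq_sum => v _; exact: old_le.
  move=> z zO; rewrite (neW _ _ uW (XW z zO)) (neW _ _ uW (gW z zO)) !addn0.
  rewrite (_ : mdeg _ _ = 0) //; rewrite /mdeg big1 // => v _; exact: walk0.
- rewrite dout //;
    case: (pickP (fun z => (z \in O) && (u \in z :: q z))) =>
      [z /andP[zO uz]|none].
    rewrite (bigD1 z) //= uz big1 // => z' /andP[z'O zz'].
    case uz': (u \in _) => //; case/eqP: zz'; exact: (q_disj z' z u).
  by rewrite big1 // => z zO; have := none z; rewrite zO => /= ->.
have mix u' v' : u' \in W -> v' \notin W -> m u' v' <= e u' v'.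
  move=> uW vW; rewrite /m f_sym f_out // sub0n add0n.
  have newE z : z \in O -> new z u' v' =
      ((u' == h z) && (v' == X z)) + ((u' == y z) && (v' == g z)).
    move=> zO; have [hW _ _] := hD z zO; have [yW _] := yD z zO.
    by rewrite /new walk0 // /edge (neW' (h z) v') // (neW' (y z) v') // !andbF
      !addn0.
  apply: sum_le_cond => [z z' zO z'O|z zO].
    rewrite !newE // !addn_gt0 !lt0b =>
      /orP[]/andP[/eqP uz /eqP vz] /orP[]/andP[/eqP uz' /eqP vz'].
    - apply: (q_disj z z' v') => //; first by rewrite vz mem_last.
      by rewrite vz' mem_last.
    - by have := hy z z' zO z'O; rewrite -uz -uz' eqxx.
    - by have := hy z' z z'O zO; rewrite -uz -uz' eqxx.
    - by apply: g_inj => //; rewrite -vz -vz'.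
  rewrite newE //; case: (u' =P h z) => [->|_] /=.
    rewrite (negbTE (hy _ _ _ _)) // addn0; case: eqP => // ->.
    by have [_ -> _] := hD z zO.
  by case: andP => // -[/eqP-> /eqP->]; rewrite e_sym; have [_ ->] := gP zO.
case: (boolP (u \in W)) => uW; case: (boolP (v \in W)) => vW.
- rewrite /m [X in _ + X]big1 ?addn0.
    by rewrite (leq_trans (leq_subr _ _)) // f_le.
  by move=> z zO; have [hW _ _] := hD z zO;
    rewrite /new walk0 // !edge_out ?XW ?gW.
- exact: mix.
- by rewrite m_sym e_sym; exact: mix.
- rewrite /m f_out // sub0n add0n.
  have newE z : z \in O -> new z u v = walk z (q z) u v.
    move=> zO; have [hW _ _] := hD z zO; have [yW _] := yD z zO;
      rewrite /new /edge.
    rewrite (neW' _ _ hW uW) (neW' _ _ yW uW) (neW' _ _ hW vW) (neW' _ _ yW vW).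
    by rewrite !andbF !addn0.
  apply: sum_le_cond => [z z' zO z'O|z zO]; last first.
    by rewrite newE //; have [/path_eC_e ezq Uq] := q_path zO; exact: walk_le.
  have inw t : t \in O -> 0 < new t u v -> u \in t :: q t.
    by move=> tO; rewrite newE // => t_gt0;
      apply: contraLR t_gt0 => /walk_notin->.
  by move=> /(inw _ zO) uz /(inw _ z'O) uz'; exact: (q_disj z z' u).
Qed.

End CyclicExchange.

(** Without attached vertices any rich pair will do. Otherwise each attached [z] leads to a rich
    [X z]; if all of these are blocked, the blocking vertices [g z] are again attached, and [g]
    permutes some nonempty set of them. *)
Lemma exists_sink z0 : z0 \notin W ->
  exists x H, rich x H /\
    (forall z y, z \notin W -> y \in nbrs H -> ~~ e z y).
Proof.
move=> z0W; case: (set_0Vmem attached) => [att0|[z1 z1a]].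
  have [x [H xH]] := exists_rich z0W; exists x, H; split=> // z y zW yN.
  have [yW Dy _] := nbrs_rich xH yN; apply/negP => ezy.
  suff : z \in attached by rewrite att0 inE.
  by apply/attachedP; split=> //; exists y.
have /fin_all_exists[q qP] z : exists p, z \in attached ->
    [/\ path eC z p, uniq (z :: p) & min_degree e - 1 <= #|high (last z p)|].
  case: (boolP (z \in attached)) => [/attachedP[zW [y [yW ezy Dy]]]|_];
    last by exists [::].
  have [|p pP] := rich_end zW yW ezy; last by exists p.
  by rewrite Dy; move: hb; clear; lia.
pose X z := last z (q z).
have XW z : z \in attached -> X z \notin W.
  move=> za; have [ezq _ _] := qP z za; have /attachedP[zW _] := za.
  by apply: (path_eC_out zW ezq); exact: mem_last.
case: (boolP [exists z in attached, [forall t, forall y,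
         (t \notin W) ==> (y \in nbrs (high (X z))) ==> ~~ e t y]]).
  case/exists_inP=> z za /forallP sink; exists (X z), (high (X z)); split.
    by apply: rich_high; [exact: XW | have [] := qP z za].
  by move=> t y tW yN; move/forallP: (sink t) => /(_ y); rewrite tW yN.
rewrite negb_exists_in => /forall_inP nosink.
have /fin_all_exists[y yP] z : exists y, z \in attached ->
    y \in nbrs (high (X z)) /\ exists t, t \notin W /\ e t y.
  case: (boolP (z \in attached)) => [za|_]; last by exists z.
  have := nosink z za; rewrite negb_forall => /existsP[t].
  rewrite negb_forall => /existsP[y].
  rewrite !negb_imply => /and4P[tW yN ety _].
  by exists y => _; split=> //; exists t.
have /fin_all_exists[h hP] z : exists h, z \in attached ->
    h \in high (X z) /\ f h (y z).
  case: (boolP (z \in attached)) => [za|_]; last by exists z.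
  by have [/nbrsP[h hX fhy] _] := yP z za; exists h.
(* The blocking vertex is chosen as a function of [y z] alone, as the cyclic exchange requires. *)
pose p v := odflt v [pick t | (t \notin W) && e t v].
pose g z := p (y z).
have gP z : z \in attached -> g z \notin W /\ e (g z) (y z).
  move=> za; have [_ [t [tW ety]]] := yP z za; rewrite /g /p.
  by case: pickP => [t' /andP[]//|/(_ t)]; rewrite tW ety.
have g_att z : z \in attached -> g z \in attached.
  move=> za; have [gW egy] := gP z za; apply/attachedP; split=> //.
  exists (y z); have [yN _] := yP z za.
  have rX : rich (X z) (high (X z)) by apply: rich_high;
    [exact: XW | have [] := qP z za].
  by have [] := nbrs_rich rX yN.
pose P (O : {set T}) := [&& O != set0, O \subset attached & g @: O \subset O].
have Patt : P attached.
  apply/and3P; split=> //; first by apply/set0Pn; exists z1.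
  by apply/subsetP=> _ /imsetP[z za ->]; exact: g_att.
(* The image of a minimal nonempty [g]-stable set is again nonempty and stable, so it is the whole
   set. *)
have [O /minsetP[/and3P[O0 Oatt gO] Omin] _] := minset_exists Patt.
have Oa z : z \in O -> z \in attached by exact: (subsetP Oatt).
case/negP: (O0); apply/eqP; apply: (@no_cyclic_exchange q h y g O) => //.
- by move=> z /Oa za; have [? ? _] := qP z za.
- by move=> z /Oa za; have [] := hP z za.
- by move=> z /Oa za; have [] := hP z za.
- by move=> z /Oa /gP.
- by move=> z z' _ _ yzz'; rewrite /g yzz'.
- apply: Omin => //; apply/and3P; split.
  + by rewrite imset_eq0.
  + exact: subset_trans gO Oatt.
  + exact: imsetS.
Qed.

End Extremal.

(** * Components and covered vertices *)

Section Components.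

Variables (T : finType) (f : rel T).
Hypothesis f_sym : symmetric f.

Lemma degree_in_component C x : C \in components f -> x \in C ->
  degree_in f C x = degree f x.
Proof.
case/imsetP=> x0 _ ->; rewrite inE => x0x; apply: eq_card => y; rewrite !inE.
by case fxy: (f x y); rewrite ?andbF // (connect_trans x0x (connect1 fxy)).
Qed.

Lemma degree_component C x : C \in components f -> x \in C -> 3 <= #|C| ->
  0 < degree f x.
Proof.
case/imsetP=> x0 _ ->; rewrite inE => x0x; apply: contraTT.
rewrite -eqn0Ngt cards_eq0 -leqNgt => /eqP f0; rewrite ltnW // ltnS -(cards1 x).
apply/subset_leq_card/subsetP=> y; rewrite !inE => x0y.
have /connectP[[|z p] /=] : connect f x y.
  by apply: connect_trans x0y; rewrite (sym_connect_sym f_sym).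
  by move=> _ ->.
case/andP=> fxz _ _; have : z \in [set y | f x y] by rewrite inE.
by rewrite f0 inE.
Qed.

(** A covered vertex and two of its neighbours already make three vertices of its component, while a
    vertex of degree 0 is a component by itself. *)
Lemma large_verticesE : irreflexive f ->
  (forall v, 0 < degree f v -> 2 <= degree f v) ->
  large_vertices f = covered f.
Proof.
move=> f_irr f_deg; apply/setP=> u; rewrite [RHS]inE; apply/bigcupP/idP.
  by case=> C /andP[Cf C3] uC; exact: (degree_component Cf).
move=> Du; exists [set y | connect f u y]; last by rewrite inE connect0.
rewrite imset_f //=; apply: leq_trans (_ : #|u |: [set y | f u y]| <= _).
  by rewrite cardsU1 inE f_irr; exact: f_deg.
apply/subset_leq_card/subsetP=> y; rewrite !inE => /predU1P[->|/connect1//].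
exact: connect0.
Qed.

End Components.

(** * The independence number outside the large components *)

Theorem theorem2 (b : nat) (hb : 4 <= b)
  (T : finType) (e : rel T) (e_sym : symmetric e) (e_irr : irreflexive e)
  (hdelta : 2 <= min_degree e)
  (halpha : b * (min_degree e - 1) < 2 * indep_num e) :
  exists f : rel T,
    pseudo_2b_factor e b f /\
    indep_num (induced e (~: large_vertices f))
      <= indep_num e - (b * (min_degree e - 1)) %/ 2.
Proof.
have [f f_ext] := exists_extremal e b.
have [/partial_factorP[f_sym f_sub f_deg] _] := f_ext.
exists f; split.
  split=> // C Cf C3 x xC; rewrite degree_in_component //.
  have := degree_component f_sym Cf xC C3; have := f_deg x.
  by case: (degree f x).
rewrite large_verticesE //; last 2 first.
- by move=> u; apply/negbTE; apply: contraFN (e_irr u); exact: f_sub.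
- by move=> v; have := f_deg v; case: (degree f v) => //= d /andP[].
apply/bigmax_leqP => S Sind.
(* [S] lives on the subtype of uncovered vertices and is transported to [T]. *)
rewrite -(card_imset (mem S) val_inj); set S' := _ @: _.
have S'W : S' \subset ~: covered f by apply/subsetP=> _ /imsetP[u _ ->];
  exact: valP.
have S'ind : independent e S'.
  apply/forall_inP => _ /imsetP[u uS ->];
    apply/forall_inP => _ /imsetP[v vS ->].
  by move/forall_inP: Sind => /(_ u uS)/forall_inP/(_ v vS).
(* If F covers every vertex there is no sink to find, but then [S'] is empty. *)
case: (set_0Vmem (~: covered f)) => [W0|[z]].
  by move: S'W; rewrite W0 subset0 => /eqP->; rewrite cards0.
rewrite in_setC => zW.
have [x [H [xH sink]]] := exists_sink e_sym e_irr hb f_ext zW.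
have := indep_bound e_sym e_irr hb f_ext xH sink S'W S'ind.
clear; lia.
Qed.
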